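(* The counit of a weak multiplier bialgebra over a field $k$ is uniquely determined by the multiplication and the comultiplication: if $(A,\mu,E,\Delta,\epsilon)$ and $(A,\mu,E',\Delta,\epsilon')$ are weak multiplier bialgebras on the same algebra $A$ with the same comultiplication $\Delta$, then $\epsilon=\epsilon'$.
   Context: Let $k$ be a field, $\otimes=\otimes_k$. A non-unital $k$-algebra $A$ with multiplication $\mu(a\otimes b)=ab$ is idempotent if $\mu$ is surjective, and has non-degenerate multiplication if ($ab=0\ \forall a$)$\Rightarrow b=0$ and ($ba=0\ \forall a$)$\Rightarrow b=0$. The multiplier algebra $\mathbb M(A)$ consists of pairs $(\lambda,\rho)$ of linear maps $A\to A$ with $a\lambda(b)=\rho(a)b$; it is a unital algebra ($(\lambda',\rho')(\lambda,\rho)=(\lambda'\lambda,\rho\rho')$, $1=(\mathrm{id},\mathrm{id})$) containing $A$ as a dense two-sided ideal. $A\otimes A\subseteq\mathbb M(A)\otimes\mathbb M(A)\subseteq\mathbb M(A\otimes A)$. $\langle X\rangle$ is linear span. A multiplicative linear $\gamma:A\to\mathbb M(B)$ with an idempotent $e\in\mathbb M(B)$ such that $\langle\gamma(a)b\rangle=eB$, $\langle b\gamma(a)\rangle=Be$ has a unique multiplicative extension $\overline\gamma:\mathbb M(A)\to\mathbb M(B)$ with $\overline\gamma(1)=e$. A weak multiplier bialgebra over $k$ is an idempotent algebra $A$ with non-degenerate multiplication $\mu$, an idempotent $E\in\mathbb M(A\otimes A)$, a multiplicative linear $\Delta:A\to\mathbb M(A\otimes A)$ and a linear $\epsilon:A\to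 k$ such that: (i) $T_1(a\otimes b):=\Delta(a)(1\otimes b)$ and $T_2(a\otimes b):=(a\otimes1)\Delta(b)$ lie in $A\otimes A$; (ii) $(T_2\otimes\mathrm{id})(\mathrm{id}\otimes T_1)=(\mathrm{id}\otimes T_1)(T_2\otimes\mathrm{id})$; (iii) $(\epsilon\otimes\mathrm{id})T_1=\mu=(\mathrm{id}\otimes\epsilon)T_2$; (iv) $\langle\Delta(a)(b\otimes b')\rangle=\langle E(b\otimes b')\rangle$ and $\langle(b\otimes b')\Delta(a)\rangle=\langle(b\otimes b')E\rangle$ ($a,b,b'$ ranging over $A$); (v) $(E\otimes1)(1\otimes E)=E^{(3)}=(1\otimes E)(E\otimes1)$ where $E^{(3)}:=(\overline{\mathrm{id}\otimes\Delta})(E)=(\overline{\Delta\otimes\mathrm{id}})(E)$; (vi) $(\epsilon\otimes\mathrm{id})((1\otimes a)E(b\otimes c))=(\epsilon\otimes\mathrm{id})(\Delta(a)(b\otimes c))$ and $(\epsilon\otimes\mathrm{id})((a\otimes b)E(1\otimes c))=(\epsilon\otimes\mathrm{id})((a\otimes b)\Delta(c))$ for all $a,b,c\in A$. *)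

(* Defs.v *)
(* Weak multiplier bialgebras over a field K.

   Conventions:
   - A non-unital K-algebra is an lmodType K together with a bilinear,
     associative multiplication [mul] (MathComp rings are unital).
   - Elements of A(x)A (resp. A(x)A(x)A) are represented by finite lists of
     pairs (resp. triples) [s], standing for sum_i a_i (x) b_i.  Two lists
     denote the same tensor iff they agree under every bilinear (trilinear)
     map into every K-vector space (universal property of the tensor
     product): [teq2], [teq3].
   - A linear map out of A(x)A is given by its values on elementary tensors,
     a map A -> A -> (A(x)A) which is bilinear up to [teq2] (universal
     property); it acts on lists by [app2].
   - A multiplier of A(x)A is a pair (lambda, rho) of such linear maps with
     x lambda(y) = rho(x) y.  Similarly for A(x)A(x)A. *)
From HB Require Import structures.
From Stdlib Require Import List.
From mathcomp Require Import all_boot all_order all_algebra.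
Set Implicit Arguments. Unset Strict Implicit. Unset Printing Implicit Defensive.
Import GRing.Theory.
Local Open Scope ring_scope.

Section WMB.
Variables (K : fieldType) (A : lmodType K).

Definition T2 := seq (A * A).
Definition T3 := seq (A * A * A).

Definition bilin_map (V : lmodType K) (f : A -> A -> V) :=
  (forall r a a' b, f (r *: a + a') b = r *: f a b + f a' b) /\
  (forall r a b b', f a (r *: b + b') = r *: f a b + f a b').

Definition trilin_map (V : lmodType K) (f : A -> A -> A -> V) :=
  [/\ (forall r a a' b c, f (r *: a + a') b c = r *: f a b c + f a' b c),
      (forall r a b b' c, f a (r *: b + b') c = r *: f a b c + f a b' c) &
      (forall r a b c c', f a b (r *: c + c') = r *: f a b c + f a b c')].

Definition sum2 (V : lmodType K) (f : A -> A -> V) (s : T2) : V :=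
  \sum_(p <- s) f p.1 p.2.
Definition sum3 (V : lmodType K) (f : A -> A -> A -> V) (s : T3) : V :=
  \sum_(p <- s) f p.1.1 p.1.2 p.2.

Definition teq2 (s t : T2) : Prop :=
  forall (V : lmodType K) (f : A -> A -> V), bilin_map f -> sum2 f s = sum2 f t.
Definition teq3 (s t : T3) : Prop :=
  forall (V : lmodType K) (f : A -> A -> A -> V), trilin_map f -> sum3 f s = sum3 f t.

Definition scale2 (r : K) (s : T2) : T2 := [seq (r *: p.1, p.2) | p <- s].
Definition scale3 (r : K) (s : T3) : T3 := [seq (r *: p.1.1, p.1.2, p.2) | p <- s].

Definition span2 (X : T2 -> Prop) (t : T2) : Prop :=
  exists l : seq (K * T2), (forall p, In p l -> X p.2) /\
    teq2 t (flatten [seq scale2 p.1 p.2 | p <- l]).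

Definition lin2 (L : A -> A -> T2) :=
  (forall r a a' b, teq2 (L (r *: a + a') b) (scale2 r (L a b) ++ L a' b)) /\
  (forall r a b b', teq2 (L a (r *: b + b')) (scale2 r (L a b) ++ L a b')).
Definition lin3 (L : A -> A -> A -> T3) :=
  [/\ (forall r a a' b c, teq3 (L (r *: a + a') b c) (scale3 r (L a b c) ++ L a' b c)),
      (forall r a b b' c, teq3 (L a (r *: b + b') c) (scale3 r (L a b c) ++ L a b' c)) &
      (forall r a b c c', teq3 (L a b (r *: c + c')) (scale3 r (L a b c) ++ L a b c'))].

Definition app2 (L : A -> A -> T2) (s : T2) : T2 :=
  flatten [seq L p.1 p.2 | p <- s].
Definition app3 (L : A -> A -> A -> T3) (s : T3) : T3 :=
  flatten [seq L p.1.1 p.1.2 p.2 | p <- s].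

Variable mul : A -> A -> A.

Definition mul2 (s t : T2) : T2 :=
  [seq (mul p.1 q.1, mul p.2 q.2) | p <- s, q <- t].
Definition mul3 (s t : T3) : T3 :=
  [seq (mul p.1.1 q.1.1, mul p.1.2 q.1.2, mul p.2 q.2) | p <- s, q <- t].

Definition mu (s : T2) : A := \sum_(p <- s) mul p.1 p.2.

Record mult2 := Mult2 { ml2 : A -> A -> T2 ; mr2 : A -> A -> T2 }.
Record mult3 := Mult3 { ml3 : A -> A -> A -> T3 ; mr3 : A -> A -> A -> T3 }.

Definition is_mult2 (m : mult2) :=
  [/\ lin2 (ml2 m), lin2 (mr2 m) &
      forall x y : T2, teq2 (mul2 x (app2 (ml2 m) y)) (mul2 (app2 (mr2 m) x) y)].
Definition is_mult3 (m : mult3) :=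
  [/\ lin3 (ml3 m), lin3 (mr3 m) &
      forall x y : T3, teq3 (mul3 x (app3 (ml3 m) y)) (mul3 (app3 (mr3 m) x) y)].

Definition meq2 (m m' : mult2) :=
  forall a b, teq2 (ml2 m a b) (ml2 m' a b) /\ teq2 (mr2 m a b) (mr2 m' a b).
Definition meq3 (m m' : mult3) :=
  forall a b c, teq3 (ml3 m a b c) (ml3 m' a b c) /\ teq3 (mr3 m a b c) (mr3 m' a b c).

Definition mmul2 (m' m : mult2) : mult2 :=
  Mult2 (fun a b => app2 (ml2 m') (ml2 m a b)) (fun a b => app2 (mr2 m) (mr2 m' a b)).
Definition mmul3 (m' m : mult3) : mult3 :=
  Mult3 (fun a b c => app3 (ml3 m') (ml3 m a b c))
        (fun a b c => app3 (mr3 m) (mr3 m' a b c)).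

Definition madd2 (m m' : mult2) : mult2 :=
  Mult2 (fun a b => ml2 m a b ++ ml2 m' a b) (fun a b => mr2 m a b ++ mr2 m' a b).
Definition mscale2 (r : K) (m : mult2) : mult2 :=
  Mult2 (fun a b => scale2 r (ml2 m a b)) (fun a b => scale2 r (mr2 m a b)).
Definition madd3 (m m' : mult3) : mult3 :=
  Mult3 (fun a b c => ml3 m a b c ++ ml3 m' a b c)
        (fun a b c => mr3 m a b c ++ mr3 m' a b c).
Definition mzero3 : mult3 := Mult3 (fun _ _ _ => [::]) (fun _ _ _ => [::]).

Definition mofT2 (u : T2) : mult2 :=
  Mult2 (fun a b => mul2 u [:: (a, b)]) (fun a b => mul2 [:: (a, b)] u).
Definition m1x (b : A) : mult2 :=
  Mult2 (fun x y => [:: (x, mul b y)]) (fun x y => [:: (x, mul y b)]).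
Definition mx1 (a : A) : mult2 :=
  Mult2 (fun x y => [:: (mul a x, y)]) (fun x y => [:: (mul x a, y)]).
Definition mE1 (m : mult2) : mult3 :=
  Mult3 (fun a b c => [seq (p.1, p.2, c) | p <- ml2 m a b])
        (fun a b c => [seq (p.1, p.2, c) | p <- mr2 m a b]).
Definition m1E (m : mult2) : mult3 :=
  Mult3 (fun a b c => [seq (a, p.1, p.2) | p <- ml2 m b c])
        (fun a b c => [seq (a, p.1, p.2) | p <- mr2 m b c]).

Definition gidD (D : A -> mult2) (a b : A) : mult3 :=
  Mult3 (fun c d e => [seq (mul a c, p.1, p.2) | p <- ml2 (D b) d e])
        (fun c d e => [seq (mul c a, p.1, p.2) | p <- mr2 (D b) d e]).
Definition gDid (D : A -> mult2) (a b : A) : mult3 :=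
  Mult3 (fun c d e => [seq (p.1, p.2, mul b e) | p <- ml2 (D a) c d])
        (fun c d e => [seq (p.1, p.2, mul e b) | p <- mr2 (D a) c d]).
Definition gam (g : A -> A -> mult3) (u : T2) : mult3 :=
  foldr (fun p m => madd3 (g p.1 p.2) m) mzero3 u.

(* X is the value at m of the unique multiplicative extension of
   gamma : A(x)A -> M(A(x)A(x)A) with extension of 1 equal to e:
   X gamma(u) w = gamma(m u) w,  w gamma(u) X = w gamma(u m),  X = X e = e X *)
Definition is_ext3 (g : A -> A -> mult3) (e : mult3) (m : mult2) (X : mult3) :=
  [/\ is_mult3 X,
      (forall (u : T2) (w : T3), teq3 (app3 (ml3 X) (app3 (ml3 (gam g u)) w))
                                       (app3 (ml3 (gam g (app2 (ml2 m) u))) w)),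
      (forall (u : T2) (w : T3), teq3 (app3 (mr3 X) (app3 (mr3 (gam g u)) w))
                                       (app3 (mr3 (gam g (app2 (mr2 m) u))) w)),
      meq3 X (mmul3 X e) & meq3 X (mmul3 e X)].

Definition epsl (eps : A -> K) (s : T2) : A := \sum_(p <- s) eps p.1 *: p.2.
Definition epsr (eps : A -> K) (s : T2) : A := \sum_(p <- s) eps p.2 *: p.1.

Definition nu_algebra :=
  (forall r a a' b, mul (r *: a + a') b = r *: mul a b + mul a' b) /\
  (forall r a b b', mul a (r *: b + b') = r *: mul a b + mul a b') /\
  associative mul.
Definition idempotent_alg := forall x : A, exists s : T2, x = mu s.
Definition nondegenerate :=
  (forall b, (forall a, mul a b = 0) -> b = 0) /\
  (forall b, (forall a, mul b a = 0) -> b = 0).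

Definition is_WMB (E : mult2) (D : A -> mult2) (eps : A -> K) : Prop :=
  [/\ nu_algebra, idempotent_alg & nondegenerate] /\
      (is_mult2 E /\ meq2 (mmul2 E E) E) /\
      [/\ forall a, is_mult2 (D a),
          forall r a b, meq2 (D (r *: a + b)) (madd2 (mscale2 r (D a)) (D b)) &
          forall a b, meq2 (D (mul a b)) (mmul2 (D a) (D b))] /\
      (forall r a b, eps (r *: a + b) = r * eps a + eps b) /\
      (exists TT1 TT2 : A -> A -> T2,
        [/\ forall a b, meq2 (mofT2 (TT1 a b)) (mmul2 (D a) (m1x b)),
            forall a b, meq2 (mofT2 (TT2 a b)) (mmul2 (mx1 a) (D b)),
            (let idT1 := fun a b c => [seq (a, p.1, p.2) | p <- TT1 b c] in
             let T2id := fun a b c => [seq (p.1, p.2, c) | p <- TT2 a b] in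
             forall w : T3, teq3 (app3 T2id (app3 idT1 w)) (app3 idT1 (app3 T2id w))) &
            forall s : T2, epsl eps (app2 TT1 s) = mu s /\ epsr eps (app2 TT2 s) = mu s]) /\
      ((forall t, span2 (fun u => exists a b b', u = ml2 (D a) b b') t <->
                 span2 (fun u => exists b b', u = ml2 E b b') t) /\
      (forall t, span2 (fun u => exists a b b', u = mr2 (D a) b b') t <->
                 span2 (fun u => exists b b', u = mr2 E b b') t)) /\
      (exists E3 : mult3,
        [/\ is_ext3 (gidD D) (m1E E) E E3, is_ext3 (gDid D) (mE1 E) E E3,
            meq3 (mmul3 (mE1 E) (m1E E)) E3 & meq3 E3 (mmul3 (m1E E) (mE1 E))]) /\
      (forall a b c,
         epsl eps [seq (p.1, mul a p.2) | p <- ml2 E b c] = epsl eps (ml2 (D a) b c) /\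
         epsl eps [seq (p.1, mul p.2 c) | p <- mr2 E a b] = epsl eps (mr2 (D c) a b)).

End WMB.

(* Main.v *)
(* Write T1 (a (x) b) = Delta(a)(1 (x) b) and T2 (a (x) b) = (a (x) 1)Delta(b).
   Axiom (vi) makes (eps (x) id)T2 right A-linear in its second argument; hence,
   for any two counits, eps (x R'(y,z)) = eps (x y z), where
   R' := (id (x) eps')T1. Together with coassociativity, the case eps = eps'
   shows that R' is left A-linear in its first argument. Therefore
   eps'(a y z) = (eps (x) eps')T1 (a y (x) z) = eps (R'(a y,z)) = eps (a R'(y,z))
   = eps (a y z), and A is spanned by triple products.
   Identities in A (x) A are only available after multiplying on the right by
   elements of A (x) A; over a field linear forms separate points, so this factor
   can be cancelled from the slices (phi (x) id) and (id (x) phi) (slice_cancel). *)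
Require Import Defs.
From mathcomp Require Import all_boot all_order all_algebra.
From mathcomp Require Import boolp classical_sets.
Set Implicit Arguments. Unset Strict Implicit. Unset Printing Implicit Defensive.
Import GRing.Theory.
Local Open Scope ring_scope.

(** * Separation of points by linear forms *)

Section LinearForms.
Variables (K : fieldType) (V : lmodType K).
Local Open Scope classical_set_scope.

Let lin_closed (W : set V) := forall (r : K) a b, W a -> W b -> W (r *: a + b).

(** Zorn's lemma for subspaces not containing [v]: if [u] lies outside a maximal [W], then [W + K u]
    must contain [v]. *)
Lemma maximal_subspace_avoiding (v : V) : v != 0 ->
  exists W : set V, [/\ lin_closed W, W 0, ~ W v &
    forall u, exists c : K, W (u - c *: v)].
Proof.
move=> v0; pose P (W : set V) := lin_closed W /\ ~ W v.
have chainP (F : set (set V)) : F `<=` P -> total_on F subset ->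
    P (\bigcup_(X in F) X).
  move=> FP totF; split; last by case=> X FX Xv; case: (FP _ FX).
  move=> r a b [X FX Xa] [Y FY Yb].
  have [XY|YX] := totF _ _ FX FY.
    by exists Y => //; apply: (FP _ FY).1 => //; apply: XY.
  by exists X => //; apply: (FP _ FX).1 => //; apply: YX.
have [W [[lW Wv] maxW]] := Zorn_bigcup chainP.
(* The empty set also satisfies [P], so maximality is used here: without [0], [W] would be empty and
   lie properly inside the subspace zero. *)
have W0 : W 0.
  apply: contrapT => nW0; apply: (maxW [set 0]); last first.
    by split=> [r a b -> ->|/eqP]; rewrite ?scaler0 ?addr0 ?(negPf v0).
  split=> [x Wx|sub]; last exact/nW0/sub.
  by case: nW0; rewrite -(addNr x) -scaleN1r; apply: lW.
have Wscale r a : W a -> W (r *: a) by move=> *; rewrite -(addr0 (r *: a)); apply: lW.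
exists W; split=> // u.
have [Wu|nWu] := pselect (W u); first by exists 0; rewrite scale0r subr0.
pose B : set V := [set x | exists w k, W w /\ x = w + k *: u].
have /existsNP[w /existsNP[k /not_implyP[Ww]]] : ~ forall w k, W w -> v <> w + k *: u.
  move=> nB; apply: (maxW B).
    split=> [x Wx|sub]; first by exists x, 0; rewrite scale0r addr0.
    by apply: nWu; apply: sub; exists 0, 1; rewrite scale1r add0r.
  split; last by case=> w [k [Ww]]; apply: nB.
  move=> r _ _ [w [k [Ww ->]]] [w' [k' [Ww' ->]]].
  exists (r *: w + w'), (r * k + k'); split; first exact: lW.
  by rewrite scalerDr scalerDl scalerA addrACA.
move/contrapT => vE.
have k0 : k != 0 by apply: contra_notN Wv => /eqP k0; rewrite vE k0 scale0r addr0.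
(* From [v = w + k *: u] follows [u - k^-1 *: v = - k^-1 *: w], an element of [W]. *)
exists k^-1; rewrite vE scalerDr scalerA mulVf // scale1r opprD addrCA subrr addr0.
by rewrite -scaleNr; apply: Wscale.
Qed.

(** For nonzero [v], the coordinate along [v] modulo a maximal subspace avoiding [v] is unique,
    hence linear in the vector, and equals 1 at [v]. *)
Lemma scalar_separates (v : V) :
  (forall phi : V -> K, scalar phi -> phi v = 0) -> v = 0.
Proof.
move=> phiv; apply/eqP/negPn/negP => v0.
have [W [lW W0 Wv coord]] := maximal_subspace_avoiding v0.
have [phi phiP] := choice coord.
have uniq_coord u c : W (u - c *: v) -> phi u = c.
  move=> Wc; apply/eqP/negPn/negP => ne; apply: Wv.
  have d0 : phi u - c != 0 by rewrite subr_eq0.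
  have -> : v = (phi u - c)^-1 *: (-1 *: (u - phi u *: v) + (u - c *: v)) + 0.
    rewrite addr0 scaleN1r opprB addrA subrK -scalerBl.
    by rewrite scalerA mulVf // scale1r.
  by apply: (lW) => //; apply: (lW).
have phi_lin : scalar phi.
  move=> r a b; apply: uniq_coord.
  have -> : r *: a + b - (r * phi a + phi b) *: v =
            r *: (a - phi a *: v) + (b - phi b *: v).
    by rewrite scalerDl scalerBr scalerA opprD addrACA.
  exact: lW.
have := phiv _ phi_lin; rewrite (uniq_coord v 1) ?scale1r ?subrr // => /eqP.
by rewrite oner_eq0.
Qed.

End LinearForms.

Lemma linear_sum_scale (K : fieldType) (U V : lmodType K) (g : U -> V) I
    (s : seq I) (c : I -> K) (x : I -> U) : linear g ->
  g (\sum_(i <- s) c i *: x i) = \sum_(i <- s) c i *: g (x i).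
Proof.
move=> lg; elim: s => [|i s IH]; last by rewrite !big_cons lg IH.
by rewrite !big_nil -(subrr 0) -scaleN1r addrC lg scaleN1r addNr.
Qed.

(** * Tensors as lists and cancellation of right factors *)

Section Tensors.
Variables (K : fieldType) (A : lmodType K) (mul : A -> A -> A).

Lemma sum2_mul2 (V : lmodType K) (f : A -> A -> V) (s t : T2 A) :
  sum2 f (mul2 mul s t) =
  \sum_(p <- s) \sum_(q <- t) f (mul p.1 q.1) (mul p.2 q.2).
Proof. by rewrite /sum2 /mul2 big_allpairs_dep. Qed.

Lemma sum2_app2 (V : lmodType K) (f : A -> A -> V) L (s : T2 A) :
  sum2 f (app2 L s) = \sum_(p <- s) sum2 f (L p.1 p.2).
Proof. by rewrite /sum2 /app2 big_flatten big_map. Qed.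

Lemma sum3_app3 (V : lmodType K) (f : A -> A -> A -> V) L (s : T3 A) :
  sum3 f (app3 L s) = \sum_(p <- s) sum3 f (L p.1.1 p.1.2 p.2).
Proof. by rewrite /sum3 /app3 big_flatten big_map. Qed.

Hypotheses (mulP : nu_algebra mul) (mul_nondeg : Defs.nondegenerate mul).

Lemma linear_mull a : linear (mul a).
Proof. by case: mulP => _ [H _] r b b'; apply: H. Qed.

Lemma linear_mulr b : linear (mul^~ b).
Proof. by case: mulP => H _ r a a'; apply: H. Qed.

Lemma mul_cancell b b' : (forall a, mul a b = mul a b') -> b = b'.
Proof.
move=> H; apply/eqP; rewrite -subr_eq0 addrC -scaleN1r; apply/eqP/mul_nondeg.1 => a.
by rewrite linear_mull H scaleN1r addNr.
Qed.

Lemma mul_cancelr b b' : (forall a, mul b a = mul b' a) -> b = b'.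
Proof.
move=> H; apply/eqP; rewrite -subr_eq0 addrC -scaleN1r; apply/eqP/mul_nondeg.2 => a.
by rewrite (linear_mulr a) H scaleN1r addNr.
Qed.

(** In a slice of the first leg, nondegeneracy cancels [y], but [x] stays inside the form.
    Exchanging the order of two slices ([comm]) makes [x] a right factor of a second-leg slice,
    where it cancels too; a second exchange returns to the first leg. *)
Lemma slice_cancel (s t : T2 A) :
  (forall (V : lmodType K) (f : A -> A -> V), bilin_map f -> forall x y,
     \sum_(p <- s) f (mul p.1 x) (mul p.2 y) =
     \sum_(p <- t) f (mul p.1 x) (mul p.2 y)) ->
  forall phi : A -> K, scalar phi ->
    epsl phi s = epsl phi t /\ epsr phi s = epsr phi t.
Proof.
move=> st.
have slice (phi : A -> K) x : scalar phi ->
    \sum_(p <- s) phi (mul p.1 x) *: p.2 = \sum_(p <- t) phi (mul p.1 x) *: p.2.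
  move=> lphi; apply: mul_cancelr => y.
  rewrite !(linear_sum_scale _ _ _ (linear_mulr y)).
  apply: (st _ (fun a b => phi a *: b)); split=> r a b c.
    by rewrite lphi scalerDl scalerA.
  by rewrite scalerDr !scalerA mulrC.
have comm (phi psi : A -> K) u (g : A -> A) : scalar phi -> scalar psi -> linear g ->
    phi (g (epsr psi u)) = psi (\sum_(p <- u) phi (g p.1) *: p.2).
  move=> lphi lpsi lg; rewrite /epsr (linear_sum_scale _ _ _ lg).
  rewrite (@linear_sum_scale K A K^o phi) // (@linear_sum_scale K A K^o psi) //.
  by apply: eq_bigr => p _; apply: mulrC.
have sep x y : (forall phi : A -> K, scalar phi -> phi x = phi y) -> x = y.
  move=> xy; apply/eqP; rewrite -subr_eq0 addrC -scaleN1r; apply/eqP/scalar_separates => phi lphi.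
  by rewrite lphi xy // mulN1r addNr.
have sliceR (phi : A -> K) : scalar phi -> epsr phi s = epsr phi t.
  move=> lphi; apply: mul_cancelr => x; apply: sep => psi lpsi.
  by rewrite !(comm _ _ _ (mul^~ x)) ?slice //; apply: linear_mulr.
move=> phi lphi; split; last exact: sliceR.
by apply: sep => psi lpsi; rewrite -!(comm _ _ _ id) ?sliceR.
Qed.

Lemma mul_epsl (phi : A -> K) g (s : T2 A) : linear g ->
  g (epsl phi s) = epsl phi [seq (p.1, g p.2) | p <- s].
Proof. by move=> lg; rewrite /epsl big_map (linear_sum_scale _ _ _ lg). Qed.

Lemma mul_epsr (phi : A -> K) g (s : T2 A) : linear g ->
  g (epsr phi s) = epsr phi [seq (g p.1, p.2) | p <- s].
Proof. by move=> lg; rewrite /epsr big_map (linear_sum_scale _ _ _ lg). Qed.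

Lemma bilin_comp (V : lmodType K) (f : A -> A -> V) (g h : A -> A) :
  bilin_map f -> linear g -> linear h -> bilin_map (fun x y => f (g x) (h y)).
Proof. by move=> [f1 f2] lg lh; split=> *; rewrite ?lg ?lh (f1, f2). Qed.

End Tensors.

(** * Slices of [T1] and [T2], and uniqueness of weak counits *)

Section WeakCounit.
Variables (K : fieldType) (A : lmodType K) (mul : A -> A -> A).
Variables (D : A -> mult2 A) (TT1 TT2 : A -> A -> T2 A).
Hypotheses (mulP : nu_algebra mul) (mul_nondeg : Defs.nondegenerate mul).
Hypotheses (D_mult : forall a, is_mult2 mul (D a))
  (D_mul : forall a b, meq2 (D (mul a b)) (mmul2 (D a) (D b)))
  (T1P : forall a b, meq2 (mofT2 mul (TT1 a b)) (mmul2 (D a) (m1x mul b)))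
  (T2P : forall a b, meq2 (mofT2 mul (TT2 a b)) (mmul2 (mx1 mul a) (D b))).
Hypothesis coassoc : forall w : T3 A,
  let idT1 := fun a b c => [seq (a, p.1, p.2) | p <- TT1 b c] in
  let T2id := fun a b c => [seq (p.1, p.2, c) | p <- TT2 a b] in
  teq3 (app3 T2id (app3 idT1 w)) (app3 idT1 (app3 T2id w)).

Let mulA : associative mul. Proof. by case: mulP => _ []. Qed.
Let lid : linear (@id A). Proof. by []. Qed.
Let lmull := linear_mull mulP.

(** The multiplier identity defining [T1], evaluated at [x (x) y] and tested on [f]: the form that
    [slice_cancel] accepts. *)
Lemma T1_mulr (V : lmodType K) (f : A -> A -> V) a b x y : bilin_map f ->
  \sum_(p <- TT1 a b) f (mul p.1 x) (mul p.2 y) = sum2 f (ml2 (D a) x (mul b y)).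
Proof.
move=> bf; have := (T1P a b x y).1 _ f bf.
rewrite /= sum2_mul2 sum2_app2 big_seq1 => <-.
by apply: eq_bigr => p _; rewrite big_seq1.
Qed.

Lemma T2_mulr (V : lmodType K) (f : A -> A -> V) a b x y : bilin_map f ->
  \sum_(p <- TT2 a b) f (mul p.1 x) (mul p.2 y) =
  sum2 (fun u v => f (mul a u) v) (ml2 (D b) x y).
Proof.
move=> bf; have := (T2P a b x y).1 _ f bf.
rewrite /= sum2_mul2 sum2_app2 /= => E.
transitivity (\sum_(p <- ml2 (D b) x y) sum2 f [:: (mul a p.1, p.2)]).
  by rewrite -E; apply: eq_bigr => p _; rewrite big_seq1.
by apply: eq_bigr => p _; rewrite /sum2 big_seq1.
Qed.

Lemma D_mulr (V : lmodType K) (f : A -> A -> V) c x y u v : bilin_map f ->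
  \sum_(p <- mr2 (D c) x y) f (mul p.1 u) (mul p.2 v) =
  sum2 (fun a b => f (mul x a) (mul y b)) (ml2 (D c) u v).
Proof.
move=> bf; have [_ _ H] := D_mult c.
have := H [:: (x, y)] [:: (u, v)] _ f bf.
rewrite !sum2_mul2 big_seq1 /app2 /= !cats0 /sum2 => ->.
by apply: eq_bigr => p _; rewrite big_seq1.
Qed.

Lemma D_mulE (V : lmodType K) (f : A -> A -> V) a b x y : bilin_map f ->
  sum2 f (ml2 (D (mul a b)) x y) =
  \sum_(p <- ml2 (D b) x y) sum2 f (ml2 (D a) p.1 p.2).
Proof. by move=> bf; rewrite ((D_mul a b x y).1 _ f bf) /= sum2_app2. Qed.

(** Each structure brings its own lists representing [T1]; this lets two counits be compared on the
    same ones. *)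
Lemma T1_unique (TT1' : A -> A -> T2 A) :
  (forall a b, meq2 (mofT2 mul (TT1' a b)) (mmul2 (D a) (m1x mul b))) ->
  forall phi : A -> K, scalar phi -> forall a b,
    epsl phi (TT1' a b) = epsl phi (TT1 a b).
Proof.
move=> T1'P phi lphi a b; apply: (slice_cancel mulP mul_nondeg _ lphi).1 => V f bf x y.
rewrite T1_mulr //; have := (T1'P a b x y).1 _ f bf.
rewrite /= sum2_mul2 sum2_app2 big_seq1 => <-.
by apply: eq_bigr => p _; rewrite big_seq1.
Qed.

Lemma T2_unique (TT2' : A -> A -> T2 A) :
  (forall a b, meq2 (mofT2 mul (TT2' a b)) (mmul2 (mx1 mul a) (D b))) ->
  forall phi : A -> K, scalar phi -> forall a b,
    epsr phi (TT2' a b) = epsr phi (TT2 a b).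
Proof.
move=> T2'P phi lphi a b; apply: (slice_cancel mulP mul_nondeg _ lphi).2 => V f bf x y.
have H := (T2P a b x y).1 _ f bf; have := (T2'P a b x y).1 _ f bf.
rewrite -H /= !sum2_mul2 => E.
transitivity (\sum_(p <- TT2' a b) \sum_(q <- [:: (x, y)]) f (mul p.1 q.1) (mul p.2 q.2)).
  by apply: eq_bigr => p _; rewrite big_seq1.
by rewrite E; apply: eq_bigr => p _; rewrite big_seq1.
Qed.

(** Both sides are slices of [(x (x) w) Delta(c)]. This passes from [T2] to the right action [mr2],
    in which axiom (vi) is expressed. *)
Lemma mull_T2 (phi : A -> K) w x c : scalar phi ->
  mul w (epsl phi (TT2 x c)) = epsl phi (mr2 (D c) x w).
Proof.
move=> lphi; rewrite (mul_epsl _ _ (lmull w)).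
apply: (slice_cancel mulP mul_nondeg _ lphi).1 => V f bf y1 y2.
rewrite big_map D_mulr //.
rewrite -(T2_mulr _ _ _ _ (bilin_comp bf lid (lmull w))).
by apply: eq_bigr => p _; rewrite mulA.
Qed.

(* Both sides are [(x (x) 1) Delta(y) (1 (x) z)]. *)
Lemma mull_T1 (phi : A -> K) x y z : scalar phi ->
  let s := [seq (mul x p.1, p.2) | p <- TT1 y z] in
  let t := [seq (p.1, mul p.2 z) | p <- TT2 x y] in
  epsl phi s = epsl phi t /\ epsr phi s = epsr phi t.
Proof.
move=> lphi s t; apply: (slice_cancel mulP mul_nondeg _ lphi) => V f bf u v.
rewrite !big_map /=.
transitivity (\sum_(p <- TT1 y z) f (mul x (mul p.1 u)) (mul p.2 v)).
  by apply: eq_bigr => p _; rewrite mulA.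
rewrite (T1_mulr _ _ _ _ (bilin_comp bf (lmull x) lid)) -T2_mulr //.
by apply: eq_bigr => p _; rewrite mulA.
Qed.

(* Both sides are [(d (x) 1) Delta(a) Delta(u)]. *)
Lemma T2_T2 (phi : A -> K) d a u : scalar phi ->
  epsr phi (flatten [seq [seq (q.1, mul p.2 q.2) | q <- TT2 p.1 u] | p <- TT2 d a]) =
  epsr phi (TT2 d (mul a u)).
Proof.
move=> lphi; apply: (slice_cancel mulP mul_nondeg _ lphi).2 => V f bf x y.
have lin1 : linear (mul d) := lmull d.
rewrite T2_mulr // big_flatten big_map (D_mulE _ _ _ _ (bilin_comp bf lin1 lid)).
transitivity (\sum_(p <- TT2 d a) \sum_(q <- ml2 (D u) x y)
    f (mul p.1 q.1) (mul p.2 q.2)).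
  apply: eq_bigr => p _; rewrite big_map /=.
  rewrite -/(sum2 (fun r s => f (mul p.1 r) (mul p.2 s)) _).
  rewrite -(T2_mulr _ _ _ _ (bilin_comp bf lid (lmull p.2))).
  by apply: eq_bigr => q _; rewrite mulA.
by rewrite exchange_big; apply: eq_bigr => q _; rewrite T2_mulr.
Qed.

(** Linearity, axiom (iii) and the second half of axiom (vi), over fixed [TT1] and [TT2]. [E] is a
    parameter, as two counits may come with different idempotents. *)
Definition weak_counit (E : mult2 A) (eps : A -> K) :=
  [/\ scalar eps, forall a b, epsl eps (TT1 a b) = mul a b,
      forall a b, epsr eps (TT2 a b) = mul a b &
      forall a b c, epsl eps [seq (p.1, mul p.2 c) | p <- mr2 E a b] =
                    epsl eps (mr2 (D c) a b)].

(** Under the slice by [eps], axiom (vi) replaces [Delta(y z)] by [E (1 (x) y z)], where [z] is a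
    right factor of the second leg. *)
Lemma epsl_T2_mul E eps : weak_counit E eps -> forall x y z,
  epsl eps (TT2 x (mul y z)) = mul (epsl eps (TT2 x y)) z.
Proof.
move=> [leps _ _ epsE] x y z; apply: (mul_cancell mulP mul_nondeg) => w.
rewrite mulA !mull_T2 // -!epsE.
rewrite (mul_epsl _ _ (linear_mulr mulP z)) -map_comp.
by congr epsl; apply: eq_map => p /=; rewrite mulA.
Qed.

(* Weak multiplicativity [eps (x y_1) eps' (y_2 z) = eps (x y z)]. *)
Lemma counit_mixed E E' eps eps' : weak_counit E eps -> weak_counit E' eps' ->
  forall x y z, eps (mul x (epsr eps' (TT1 y z))) = eps (mul x (mul y z)).
Proof.
move=> epsP eps'P x y z.
have [leps _ epsr2 _] := epsP; have [leps' _ epsr2' _] := eps'P.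
have swap s : eps (epsr eps' s) = eps' (epsl eps s).
  rewrite (@linear_sum_scale K A K^o eps) // (@linear_sum_scale K A K^o eps') //.
  by apply: eq_bigr => p _; apply: mulrC.
(* With [L := (eps (x) id) T2], the chain is [eps (x R'(y,z)) = eps' (L(x,y) z) = eps' (L(x,y z)) =
   eps ((id (x) eps') T2 (x (x) y z))]. *)
rewrite (mul_epsr _ _ (lmull x)) swap (mull_T1 _ _ _ leps).1.
rewrite -(mul_epsl _ _ (linear_mulr mulP z)) -(epsl_T2_mul epsP) -swap.
by rewrite epsr2'.
Qed.

(** After left multiplication by [d], the left side is a slice of [T2 (d (x) a y)] by [eps (- z)].
    Splitting off [a] gives terms [eps (q h z)]; weak multiplicativity splits these, coassociativity
    moves [T1] onto [y (x) z], and the counit law for [T2] reassembles [d a]. *)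
Lemma epsr_T1_mul E eps : weak_counit E eps -> forall a y z,
  epsr eps (TT1 (mul a y) z) = mul a (epsr eps (TT1 y z)).
Proof.
move=> epsP a y z; have [leps _ epsr2 _] := epsP.
apply: (mul_cancell mulP mul_nondeg) => d.
have lepsz : scalar (fun u => eps (mul u z)).
  by move=> r u v; rewrite (linear_mulr mulP z) leps.
have mixed q h : eps (mul (mul q h) z) =
    \sum_(p <- TT1 h z) eps p.2 * eps (mul q p.1).
  rewrite -mulA -(counit_mixed epsP epsP) (mul_epsr _ _ (lmull q)) /epsr.
  by rewrite (@linear_sum_scale K A K^o eps) // big_map.
have coassoc_eps p q :
    \sum_(g <- TT2 p y) \sum_(u <- TT1 g.2 z) (eps u.2 * eps (mul q u.1)) *: g.1 =
    \sum_(u <- TT1 y z) \sum_(g <- TT2 p u.1) (eps u.2 * eps (mul q g.2)) *: g.1.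
  (* Coassociativity at [p (x) y (x) z] is tested on this map, which keeps the first leg and
     evaluates the other two. *)
  have tri : trilin_map (fun g h k : A => (eps k * eps (mul q h)) *: g).
    split=> r *; rewrite ?lmull ?leps.
    - by rewrite scalerDr !scalerA mulrC.
    - by rewrite mulrDr scalerDl scalerA mulrCA.
    - by rewrite mulrDl scalerDl scalerA mulrA.
  have := coassoc [:: (p, y, z)] tri.
  rewrite /= !sum3_app3 /app3 /= !cats0 !big_map /sum3 /= => coassocE.
  transitivity (\sum_(g <- TT2 p y)
     \sum_(w <- [seq (g.1, u.1, u.2) | u <- TT1 g.2 z])
        (eps w.2 * eps (mul q w.1.2)) *: w.1.1).
    by apply: eq_bigr => g _; rewrite big_map.
  by rewrite -coassocE; apply: eq_bigr => u _; rewrite big_map.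
have -> : mul d (epsr eps (TT1 (mul a y) z)) =
          epsr (fun u => eps (mul u z)) (TT2 d (mul a y)).
  by rewrite (mul_epsr _ _ (lmull d)) (mull_T1 _ _ _ leps).2 /epsr big_map.
rewrite -(T2_T2 _ _ _ lepsz) /epsr big_flatten big_map.
transitivity (\sum_(u <- TT1 y z) eps u.2 *: mul d (mul a u.1)); last first.
  by rewrite (linear_sum_scale _ _ _ (lmull a)) (linear_sum_scale _ _ _ (lmull d)).
(* Each [d (a u_1)] is written as [(id (x) eps) T2 (d (x) a u_1)] and expanded over [T2 (d (x) a)],
   matching the outer sum on the left. *)
under [RHS]eq_bigr => u _.
  rewrite -epsr2 -(T2_T2 _ _ _ leps) /epsr big_flatten big_map scaler_sumr.
  under eq_bigr => p _ do rewrite big_map scaler_sumr.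
  over.
rewrite exchange_big; apply: eq_bigr => -[p q] _ /=; rewrite big_map /=.
under eq_bigr => g _ do rewrite mixed scaler_suml.
rewrite coassoc_eps; apply: eq_bigr => u _; apply: eq_bigr => g _.
by rewrite scalerA.
Qed.

(* [eps' (a y z) = (eps (x) eps') (Delta (a y) (1 (x) z))]; pulling [a] out of the
   second slice leaves [eps] applied to the product, where the mixed
   multiplicativity removes [eps']. *)
Lemma weak_counit_unique E E' eps eps' : weak_counit E eps -> weak_counit E' eps' ->
  forall a y z, eps' (mul a (mul y z)) = eps (mul a (mul y z)).
Proof.
move=> epsP eps'P a y z; rewrite -(counit_mixed epsP eps'P) -(epsr_T1_mul eps'P).
have [leps epsl1 _ _] := epsP; have [leps' _ _ _] := eps'P.
rewrite mulA -epsl1 /epsl /epsr.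
rewrite (@linear_sum_scale K A K^o eps) // (@linear_sum_scale K A K^o eps') //.
by apply: eq_bigr => p _; apply: mulrC.
Qed.

End WeakCounit.

(** * Passage from triple products to all of [A], and uniqueness of the counit *)

Lemma scalar_ext_mul3 (K : fieldType) (A : lmodType K) (mul : A -> A -> A)
    (phi psi : A -> K) : nu_algebra mul -> idempotent_alg mul ->
  scalar phi -> scalar psi ->
  (forall a y z, phi (mul a (mul y z)) = psi (mul a (mul y z))) -> phi =1 psi.
Proof.
move=> mulP idem lphi lpsi H.
have scalar_sum (chi : A -> K) (g : A * A -> A) s : scalar chi ->
    chi (\sum_(p <- s) g p) = \sum_(p <- s) chi (g p).
  move=> lchi; rewrite -[in LHS](eq_bigr _ (fun p _ => scale1r (g p))).
  rewrite (@linear_sum_scale K A K^o chi) //.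
  by apply: eq_bigr => p _; apply: mul1r.
have H2 a b : phi (mul a b) = psi (mul a b).
  have [s ->] := idem b; rewrite /mu -[in mul a _](eq_bigr _ (fun p _ => scale1r (mul p.1 p.2))).
  rewrite (linear_sum_scale _ _ _ (linear_mull mulP a)).
  by rewrite !scalar_sum //; apply: eq_bigr => p _; rewrite scale1r.
by move=> x; have [s ->] := idem x; rewrite !scalar_sum //; apply: eq_bigr => p _.
Qed.

Theorem theorem2p8 (K : fieldType) (A : lmodType K) (mul : A -> A -> A)
    (E E' : mult2 A) (D : A -> mult2 A) (eps eps' : A -> K) :
  is_WMB mul E D eps -> is_WMB mul E' D eps' -> eps =1 eps'.
Proof.
case=> [[mulP idem nondeg] [_ [[Dm _ DM] [leps [[TT1 [TT2 [T1P T2P coassoc cou]]]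
  [_ [_ epsE]]]]]]].
case=> [_ [_ [_ [leps' [[TT1' [TT2' [T1P' T2P' _ cou']]] [_ [_ epsE']]]]]]].
have app1 (L : A -> A -> T2 A) a b : app2 L [:: (a, b)] = L a b by rewrite /app2 /= cats0.
have mu1 a b : mu mul [:: (a, b)] = mul a b by rewrite /mu big_seq1.
have epsP : weak_counit mul D TT1 TT2 E eps.
  split=> // [a b|a b|a b c]; last exact: (epsE a b c).2.
    by rewrite -mu1 -(cou _).1 app1.
  by rewrite -mu1 -(cou _).2 app1.
(* The counit law of [eps'] is given for [TT1'] and [TT2']; it is carried over to the lists of the
   first structure. *)
have eps'P : weak_counit mul D TT1 TT2 E' eps'.
  split=> // [a b|a b|a b c]; last exact: (epsE' a b c).2.
    by rewrite -(T1_unique mulP nondeg T1P T1P' leps') -mu1 -(cou' _).1 app1.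
  by rewrite -(T2_unique mulP nondeg T2P T2P' leps') -mu1 -(cou' _).2 app1.
apply: (scalar_ext_mul3 mulP idem) => // a y z; symmetry.
exact: (weak_counit_unique mulP nondeg Dm DM T1P T2P coassoc epsP eps'P).
Qed.
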